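(* For $s>0$ and $x\in\mathbb{R}$ let $p(x,s)=x\cdot\frac{2}{\sqrt{\pi}}\int_0^{x/s}e^{-t^2}\,dt$. Then for all $x\in\mathbb{R}$ and all $s>0$, $$\bigl|\,|x|-p(x,s)\,\bigr|\le 2s\,\phi\Bigl(\frac{x}{s},0,\frac{1}{\sqrt{2}}\Bigr).$$ In particular, $p(x,s)\to|x|$ as $s\to0^+$.
   Context: $\phi(z,0,\frac{1}{\sqrt2})$ denotes the density at $z$ of the normal distribution with mean $0$ and standard deviation $\frac{1}{\sqrt2}$, i.e. $\phi(z,0,\frac1{\sqrt2})=\frac{1}{\sqrt{\pi}}e^{-z^2}$. The function $p(x,s)$ is the ''dlasso'' penalty; equivalently $p(x,s)=x\,\mathrm{erf}(x/s)$. *)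

(* Defs.v *)
From mathcomp Require Import all_boot all_order all_algebra.
From mathcomp Require Import all_classical all_reals all_analysis.

Set Implicit Arguments.
Unset Strict Implicit.
Unset Printing Implicit Defensive.
Import Order.TTheory GRing.Theory Num.Theory.
Import numFieldNormedType.Exports.

Local Open Scope classical_set_scope.
Local Open Scope ring_scope.

(* Since [`[a, b]] is empty when b < a, the integral from a to b with the usual
   sign convention needs both orders of the bounds. *)
Definition oriented_integral {R : realType} (a b : R) (f : R -> R) : R :=
  if a <= b then \int[lebesgue_measure]_(t in `[a, b]) f t
  else - \int[lebesgue_measure]_(t in `[b, a]) f t.

Definition dlasso {R : realType} (x s : R) : R :=
  x * (2 / Num.sqrt pi *
       oriented_integral 0 (x / s) (fun t => expR (- t ^+ 2))).

Lemma normal_pdf_invsqrt2E {R : realType} (z : R) :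
  normal_pdf 0 (Num.sqrt 2)^-1 z = (Num.sqrt pi)^-1 * expR (- z ^+ 2).
Proof.
have s0 : (Num.sqrt 2 : R)^-1 != 0 by rewrite invr_neq0// sqrtr_eq0 -ltNge.
have s2 : ((Num.sqrt 2 : R)^-1) ^+ 2 *+ 2 = 1.
  by rewrite exprVn sqr_sqrtr// -mulr_natr mulVf.
rewrite normal_pdfE// /normal_peak /normal_fun subr0.
by rewrite -mulrnAl s2 mul1r divr1.
Qed.

(* Main.v *)
Require Import Defs.
From mathcomp Require Import all_boot all_order all_algebra.
From mathcomp Require Import all_classical all_reals all_analysis.
From mathcomp Require Import measurable_realfun ring.
Import Order.TTheory GRing.Theory Num.Theory.
Import numFieldNormedType.Exports.
Local Open Scope classical_set_scope.
Local Open Scope ring_scope.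

(** Writing [u = |x| / s], evenness of the integrand and the Gaussian integral
    [sqrt pi / 2] over the half-line turn the error [|x| - p(x, s)] into
    [s / sqrt pi * 2 u * T u] with [T u] the integral of [exp (- t ^ 2)] over
    [u <= t].  On that range [u <= t], so [2 u * T u] is at most the integral of
    [2 t exp (- t ^ 2)], which is exactly [exp (- u ^ 2)]. *)

Lemma is_derive_oppr_gauss_fun (R : realType) (x : R) :
  is_derive x 1 (fun t => - gauss_fun t) (2 * x * gauss_fun x).
Proof.
rewrite /gauss_fun; apply: is_derive_eq.
rewrite /GRing.scale /=; ring.
Qed.

Lemma integrable_gauss_fun {R : realType} (D : set R) : measurable D ->
  lebesgue_measure.-integrable D (EFin \o gauss_fun).
Proof. by move=> mD; apply: integrableS integrableT_gauss. Qed.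

(** The integrand is the derivative of [- gauss_fun], which tends to [0] at infinity, so only the
    boundary term at [u] survives. *)
Lemma integral_mul_gauss_fun_tail (R : realType) (u : R) : 0 <= u ->
  (\int[lebesgue_measure]_(t in `[u, +oo[) (2 * t * gauss_fun t)%:E)%E =
  (gauss_fun u)%:E.
Proof.
move=> u0.
rewrite (@ge0_continuous_FTC2y _ _ (fun t => - gauss_fun t) _ 0).
- by rewrite -EFinB sub0r opprK.
- by move=> t /(le_trans u0) t0; rewrite !mulr_ge0 ?gauss_fun_ge0.
- apply: continuous_subspaceT => t.
  apply: cvgM; last exact: continuous_gauss_fun.
  by apply: cvgM; [exact: cvg_cst|exact: cvg_id].
- by rewrite -oppr0; apply: cvgN; exact: cvg_gauss_fun.
- by move=> t _; case: (is_derive_oppr_gauss_fun R t).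
- apply: cvg_at_right_filter; apply: cvgN; exact: continuous_gauss_fun.
- by move=> t _; rewrite derive1E; case: (is_derive_oppr_gauss_fun R t).
Qed.

Lemma Rintegral_gauss_fun_tail_le (R : realType) (u : R) : 0 <= u ->
  2 * u * \int[lebesgue_measure]_(t in `[u, +oo[) gauss_fun t <= gauss_fun u.
Proof.
move=> u0; have mg : measurable_fun `[u, +oo[ (@gauss_fun R).
  by apply: measurable_funTS; exact: measurable_gauss_fun.
rewrite -RintegralZl//; last exact: integrable_gauss_fun.
(* The scaled tail is integrable, hence finite, so the comparison can be made between extended-real
   integrals, where the right-hand side is itself a tail integral. *)
rewrite -lee_fin /Rintegral fineK; last first.
  apply: integrable_fin_num => //.
  have ig := integrable_gauss_fun `[u, +oo[ (measurable_itv _).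
  exact: (@integrableZl _ _ _ _ _ _ (2 * u) _ ig).
rewrite -integral_mul_gauss_fun_tail//.
apply: ge0_le_integral => //.
- by move=> t _; rewrite lee_fin !mulr_ge0 ?gauss_fun_ge0.
- apply/measurable_EFinP; exact: measurable_funM.
- apply/measurable_EFinP; apply: measurable_funM; last exact: mg.
  exact: measurable_funM.
- move=> t /=; rewrite in_itv/= andbT => ut.
  by rewrite lee_fin ler_wpM2r ?gauss_fun_ge0// ler_pM2l.
Qed.

Lemma Rintegral_gauss_fun_head (R : realType) (u : R) : 0 <= u ->
  \int[lebesgue_measure]_(t in `[0, u]) gauss_fun t =
  Num.sqrt pi / 2 - \int[lebesgue_measure]_(t in `[u, +oo[) gauss_fun t.
Proof.
move=> u0.
have -> : Num.sqrt pi / 2 =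
    \int[lebesgue_measure]_(t in `[0, +oo[) (@gauss_fun R t).
  by rewrite /Rintegral integral0y_gauss.
(* Dropping the null endpoint [u] from the tail makes it the exact complement of [[0, u]] in the
   half-line. *)
rewrite -Rintegral_itv_obnd_cbnd; last exact: integrable_gauss_fun.
rewrite -(@Rintegral_itvB _ _ (BLeft 0) (BInfty _ false) u) ?bnd_simp//.
  by rewrite subKr.
exact: integrable_gauss_fun.
Qed.

Lemma oriented_integral0N (R : realType) (f : R -> R) (z : R) :
  continuous f -> (forall t, f (- t) = f t) ->
  oriented_integral 0 (- z) f = - oriented_integral 0 z f.
Proof.
move=> cf fN.
(* Reflection [t -> - t]; negating [z] swaps the two branches of [oriented_integral], and either
   sign reduces to this equality with [a] the absolute value of [z]. *)
have refl a : 0 <= a -> \int[lebesgue_measure]_(t in `[- a, 0]) f t =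
    \int[lebesgue_measure]_(t in `[0, a]) f t.
  move=> a0; rewrite /Rintegral -[X in `[_, X]%classic]oppr0.
  rewrite integration_by_substitution_oppr//.
    by congr fine; apply: eq_integral => t _ /=; rewrite fN.
  exact: continuous_subspaceT.
rewrite /oriented_integral oppr_ge0; case: (ltrgtP z 0) => [z0|z0|->].
- by rewrite opprK -refl ?oppr_ge0 ?ltW// opprK.
- by rewrite refl // ltW.
- by rewrite oppr0 set_itv1 Rintegral_set1 oppr0.
Qed.

(** Both [x] and the integral up to [x / s] are odd in [x], so their product is even. *)
Lemma dlassoN (R : realType) (x s : R) : dlasso (- x) s = dlasso x s.
Proof.
rewrite /dlasso [- x / s]mulNr oriented_integral0N.
- by rewrite mulrN mulrNN.
- exact: continuous_gauss_fun.
- by move=> t; rewrite sqrrN.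
Qed.

(** The normalisation [2 / Num.sqrt pi] turns the half-line integral into [1], so the leading [x]
    cancels and only the tail remains. *)
Lemma sub_dlassoE (R : realType) (x s : R) : 0 < s -> 0 <= x ->
  x - dlasso x s = s * (Num.sqrt pi)^-1 * (2 * (x / s) *
    \int[lebesgue_measure]_(t in `[x / s, +oo[) gauss_fun t).
Proof.
move=> s0 x0; have z0 : 0 <= x / s by rewrite divr_ge0// ltW.
rewrite /dlasso /oriented_integral z0 (Rintegral_gauss_fun_head R _ z0).
set T := Rintegral _ _ _.
have p0 : Num.sqrt pi != 0 :> R by rewrite gt_eqF// sqrtr_gt0 pi_gt0.
by field; rewrite p0 gt_eqF.
Qed.

Lemma dlasso_dist_le (R : realType) (x s : R) : 0 < s ->
  `| `|x| - dlasso x s | <= 2 * s * normal_pdf 0 (Num.sqrt 2)^-1 (x / s).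
Proof.
(* Both sides are even in [x]: the density depends only on the square of [x / s]. *)
move=> s0; wlog x0 : x / 0 <= x.
  move=> H; have [|/ltW x0] := leP 0 x; first exact: H.
  have := H (- x); rewrite oppr_ge0 dlassoN normrN mulNr => /(_ x0).
  by rewrite !normal_pdf_invsqrt2E sqrrN.
have z0 : 0 <= x / s by rewrite divr_ge0// ltW.
have c0 : 0 <= s * (Num.sqrt pi)^-1 by rewrite divr_ge0 ?sqrtr_ge0// ltW.
have T0 : 0 <= \int[lebesgue_measure]_(t in `[x / s, +oo[) (@gauss_fun R t).
  by apply: Rintegral_ge0 => t _; exact: gauss_fun_ge0.
rewrite (ger0_norm x0) sub_dlassoE// ger0_norm; last first.
  by rewrite mulr_ge0// mulr_ge0// mulr_ge0.
rewrite normal_pdf_invsqrt2E -/(gauss_fun _) -mulrA.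
(* The tail bound yields one copy of [gauss_fun (x / s)]; the second copy is nonnegative slack. *)
rewrite [leRHS](_ : _ = s * (Num.sqrt pi)^-1 * (gauss_fun (x / s) *+ 2));
  last by ring.
rewrite mulrA ler_wpM2l// (le_trans (Rintegral_gauss_fun_tail_le R _ z0))//.
by rewrite mulr2n lerDl gauss_fun_ge0.
Qed.

Lemma dlasso_cvg (R : realType) (x : R) : dlasso x s @[s --> 0^'+] --> `|x|.
Proof.
have p0 : 0 < Num.sqrt pi :> R by rewrite sqrtr_gt0 pi_gt0.
apply/cvgrPdist_le => e e0; near=> s.
have s0 : 0 < s by near: s; exact: nbhs_right_gt.
apply: (le_trans (dlasso_dist_le R x s s0)).
rewrite normal_pdf_invsqrt2E.
(* The density is at most its peak [(Num.sqrt pi)^-1], so the error is linear in [s] and falls below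
   [e] once [s <= e * Num.sqrt pi / 2]. *)
apply: (@le_trans _ _ (2 * s * (Num.sqrt pi)^-1)).
  by rewrite mulrA ler_piMr ?gauss_fun_le1// !mulr_ge0 ?invr_ge0 ?ltW.
rewrite ler_pdivrMr// mulrC -ler_pdivlMr//.
by near: s; apply: nbhs_right_le; rewrite divr_gt0// mulr_gt0.
Unshelve. all: by end_near. Qed.

Theorem mainTheorem1 (R : realType) :
  (forall x s : R, 0 < s ->
     `| `|x| - dlasso x s | <= 2 * s * normal_pdf 0 (Num.sqrt 2)^-1 (x / s))
  /\ (forall x : R, dlasso x s @[s --> 0^'+] --> `|x|).
Proof. by split=> [x s|x]; [exact: dlasso_dist_le|exact: dlasso_cvg]. Qed.
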